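(* Let $X$ and $Y$ be Banach spaces, let $\mathfrak I$ be a testing ideal and let $\Delta_{\mathfrak I}$ be the associated ideal-generated assignment. For $\Phi\in\Delta_{\mathfrak I}(X\widehat\otimes_\varepsilon Y)$ let $L_\Phi:X^*\to Y^{**}$ be given by $L_\Phi(x^* )(y^* )=\Phi(\widehat G(x^*\otimes y^* ))$. Assume that the map $T:\Phi\mapsto L_\Phi$ is a well-defined isometric isomorphism from $\Delta_{\mathfrak I}(X\widehat\otimes_\varepsilon Y)$ onto $X\widehat\otimes_\varepsilon\Delta_{\mathfrak I}(Y)$ (whose elements are viewed as operators $X^*\to\Delta_{\mathfrak I}(Y)\subset Y^{**}$). Assume additionally that $Y$ is complemented in $\Delta_{\mathfrak I}(Y)$. Then \[ \mathcal S_{\mathfrak I}(X\widehat\otimes_\varepsilon Y)\sim X\widehat\otimes_\varepsilon\mathcal S_{\mathfrak I}(Y). \]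
   Context: Banach spaces are real; $X\subset X^{**}$ canonically; $\sim$ denotes linear isomorphism; $\widehat\otimes_\varepsilon$ and $\widehat\otimes_\pi$ are the injective and projective tensor products. A testing ideal is a rule $\mathfrak I$ assigning to each Banach space $X$ an ideal $\mathfrak I(X^* )$ of subsets of $X^*$ (a family containing $\emptyset$, closed under subsets and finite unions) such that: (1) every countable subset of $X^*$ is in $\mathfrak I(X^* )$; (2) if $T:X\to Y$ is bounded linear and $A\in\mathfrak I(Y^* )$, then $T^*(A)\in\mathfrak I(X^* )$; (3) if $X,Y$ are Banach spaces, $A\in\mathfrak I(\mathcal L(X,Y^* ))$ (where $\mathcal L(X,Y^* )\cong(X\widehat\otimes_\pi Y)^*$) and $y^{**}\in\Delta_{\mathfrak I}(Y)$, then $\{y^{**}\circ T:T\in A\}\in\mathfrak I(X^* )$. Here $\Delta_{\mathfrak I}(X)$ is the norm closure in $X^{**}$ of \[\Delta^0_{\mathfrak I}(X)=\{x^{**}\in X^{**}:\forall A\in\mathfrak I(X^* )\ \exists x\in X\ \text{with}\ x^{**}|_A=x|_A\},\] called the ideal-generated assignment, and $\mathcal S_{\mathfrak I}(X)=\Delta_{\mathfrak I}(X)/X$. $\widehat G:X^*\widehat\otimes_\pi Y^*\to(X\widehat\otimes_\varepsilon Y)^*$ is the canonical norm-one operator determined by $\widehat G(x^*\otimes y^* )(x\otimes y)=x^*(x)y^*(y)$. Elements of $X\widehat\otimes_\varepsilon Z$ are viewed as operators $X^*\to Z$ via $(x\otimes z)(x^* )=x^*(x)z$. *)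

(* Defs.v *)
From HB Require Import structures.
From mathcomp Require Import all_boot all_order all_algebra.
From mathcomp Require Import ring.
From mathcomp Require Import all_classical all_reals all_analysis.

Set Implicit Arguments.
Unset Strict Implicit.
Unset Printing Implicit Defensive.

Import Order.TTheory GRing.Theory Num.Theory.
Import numFieldNormedType.Exports.

Local Open Scope classical_set_scope.
Local Open Scope ring_scope.

Section BoundedOperators.
Context {R : realType} (X Y : normedModType R).

Definition bounded_linear : {pred (X -> Y)} :=
  fun f => `[< linear f /\ exists C : R, forall x, `|f x| <= C * `|x| >].

Lemma bounded_linear_submod : submod_closed bounded_linear.
Proof.
split.
  apply/asboolP; split=> [a x y|]; first by rewrite scaler0 addr0.
  by exists 0 => x; rewrite normr0 mul0r.
move=> a f g /asboolP [lf [C hf]] /asboolP [lg [D hg]]; apply/asboolP; split.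
  move=> b x y.
  have E z : (a *: f + g) z = a *: f z + g z by [].
  by rewrite !E lf lg !scalerDr !scalerA (mulrC a b) addrACA.
exists (`|a| * C + D) => x.
apply: (le_trans (ler_normD _ _)).
by rewrite normrZ mulrDl lerD// -mulrA ler_wpM2l.
Qed.

HB.instance Definition _ :=
  GRing.isSubmodClosed.Build R (X -> Y) bounded_linear bounded_linear_submod.

(* L(X, Y), the space of bounded linear operators. *)
Record bop := Bop { bop_fun :> X -> Y ; bopP : bop_fun \in bounded_linear }.

HB.instance Definition _ := [isSub for bop_fun].
HB.instance Definition _ := [Choice of bop by <:].
HB.instance Definition _ := [SubChoice_isSubLmodule of bop by <:].

Lemma bop_linear (f : bop) : linear f.
Proof. by have /asboolP[] := bopP f. Qed.

HB.instance Definition _ (f : bop) :=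
  GRing.isLinear.Build R X Y *:%R f (bop_linear f).

Lemma bop_bounded (f : bop) : exists C : R, forall x, `|f x| <= C * `|x|.
Proof. by have /asboolP[] := bopP f. Qed.

Lemma bopE (f g : bop) : f =1 g -> f = g.
Proof. by move=> /funext fg; apply: val_inj. Qed.

Lemma bopDE (f g : bop) x : (f + g) x = f x + g x. Proof. by []. Qed.
Lemma bopNE (f : bop) x : (- f) x = - f x. Proof. by []. Qed.
Lemma bopBE (f g : bop) x : (f - g) x = f x - g x. Proof. by []. Qed.
Lemma bopZE (a : R) (f : bop) x : (a *: f) x = a *: f x. Proof. by []. Qed.
Lemma bop0E x : (0 : bop) x = 0. Proof. by []. Qed.

(* The operator norm: the supremum of `|f x| over the closed unit ball. *)
Definition bop_norm (f : bop) : R := sup [set `|f x| | x in [set x | `|x| <= 1]].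

Let bound_subproof (f : bop) :
  has_sup [set `|f x| | x in [set x | `|x| <= 1]].
Proof.
split; first by exists `|f 0|, 0 => //=; rewrite normr0.
have [C hC] := bop_bounded f; exists `|C| => _ [x /= x1 <-].
apply: (le_trans (hC x)); apply: (le_trans (ler_norm _)).
by rewrite normrM normr_id ler_piMr.
Qed.

Let normP (f : bop) x : `|f x| <= bop_norm f * `|x|.
Proof.
have [->|x0] := eqVneq x 0; first by rewrite linear0 !normr0 mulr0.
have nx0 : 0 < `|x| by rewrite normr_gt0.
rewrite -ler_pdivrMr//.
apply: (ub_le_sup (bound_subproof f).2); exists (`|x|^-1 *: x) => /=.
  by rewrite normrZ normfV normr_id mulVf// gt_eqF.
by rewrite linearZ normrZ normfV normr_id mulrC.
Qed.

Let norm_le (f : bop) (C : R) : 0 <= C -> (forall x, `|f x| <= C * `|x|) ->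
  bop_norm f <= C.
Proof.
move=> C0 hC; apply: ge_sup; first exact: (bound_subproof f).1.
by move=> _ [x /= x1 <-]; apply: (le_trans (hC x)); rewrite ler_piMr.
Qed.

Let norm_ge0 (f : bop) : 0 <= bop_norm f.
Proof.
apply: (le_trans (normr_ge0 (f 0))).
by apply: (ub_le_sup (bound_subproof f).2); exists 0 => /=; rewrite ?normr0.
Qed.

Let norm_triangle (f g : bop) : bop_norm (f + g) <= bop_norm f + bop_norm g.
Proof.
apply: norm_le => [|x]; first by rewrite addr_ge0.
by rewrite bopDE (le_trans (ler_normD _ _))// mulrDl lerD// normP.
Qed.

Let norm_scaleW (a : R) (f : bop) : bop_norm (a *: f) <= `|a| * bop_norm f.
Proof.
apply: norm_le => [|x]; first by rewrite mulr_ge0.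
by rewrite bopZE normrZ -mulrA ler_wpM2l// normP.
Qed.

Let norm_scale (a : R) (f : bop) : bop_norm (a *: f) = `|a| * bop_norm f.
Proof.
apply/le_anti/andP; split => //.
have [->|a0] := eqVneq a 0; first by rewrite normr0 mul0r.
have := norm_scaleW a^-1 (a *: f).
by rewrite scalerA mulVf// scale1r normfV ler_pdivlMl// normr_gt0.
Qed.

Let norm_eq0 (f : bop) : bop_norm f = 0 -> f = 0.
Proof.
move=> f0; apply: bopE => x; apply/eqP; rewrite -normr_le0.
by have := normP f x; rewrite f0 mul0r.
Qed.

HB.instance Definition _ := Lmodule_isNormed.Build R bop
  norm_triangle norm_scale norm_eq0.

Lemma bop_normE (f : bop) :
  `|f| = sup [set `|f x| | x in [set x | `|x| <= 1]].
Proof. by []. Qed.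

Lemma bop_normP (f : bop) x : `|f x| <= `|f| * `|x|.
Proof. exact: normP. Qed.

Lemma bop_norm_le (f : bop) (C : R) : 0 <= C ->
  (forall x, `|f x| <= C * `|x|) -> `|f| <= C.
Proof. exact: norm_le. Qed.

Lemma mkbop_subproof (f : X -> Y) : linear f ->
  (exists C : R, forall x, `|f x| <= C * `|x|) -> f \in bounded_linear.
Proof. by move=> lf bf; apply/asboolP. Qed.

Definition mkbop (f : X -> Y) (lf : linear f)
  (bf : exists C : R, forall x, `|f x| <= C * `|x|) : bop :=
  Bop (mkbop_subproof lf bf).

Lemma bop_continuous (f : bop) : continuous f.
Proof.
have := @bounded_linear_continuous R X Y f; apply.
apply/linear_boundedP; exists `|f|; split; first exact: num_real.
move=> r fr x; apply: (le_trans (bop_normP f x)).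
by rewrite ler_wpM2r// ltW.
Qed.

End BoundedOperators.

Arguments bounded_linear {R X Y}.

Section BopComplete.
Context {R : realType} (X : normedModType R) (Y : completeNormedModType R).

Lemma bop_complete (F : set_system (bop X Y)) :
  ProperFilter F -> cauchy F -> cvg F.
Proof.
move=> FF /cauchy_ballP Fc.
have cF e : 0 < e -> exists2 A, F A & forall f g, A f -> A g -> `|f - g| < e.
  move=> e0; have /cauchy_ballP/cauchyP/(_ (e / 2)) := Fc.
  case; first by rewrite divr_gt0.
  move=> h Fh; exists (ball h (e / 2)) => // f g.
  rewrite -!ball_normE /= => hf hg.
  rewrite -(subrK h f) -addrA (splitr e).
  by rewrite (le_lt_trans (ler_normD _ _))// ltrD// distrC// -opprB normrN.
have cx x : cvg ((fun f : bop X Y => f x) @ F).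
  apply: cauchy_cvg; apply/cauchy_ballP => e e0.
  have e0' : 0 < e / (`|x| + 1) by rewrite divr_gt0// ltr_wpDl.
  have [A FA hA] := cF _ e0'.
  exists ((fun f : bop X Y => f x) @` A, (fun f : bop X Y => f x) @` A).
    by split=> /=; apply: (@filterS _ F _ A) => // f Af; exists f.
  move=> [_ _] [/= [f Af <-] [g Ag <-]].
  rewrite -ball_normE /= -bopBE (le_lt_trans (bop_normP _ _))//.
  apply: (@le_lt_trans _ _ (e / (`|x| + 1) * `|x|)).
    by rewrite ler_wpM2r// ltW// hA.
  by rewrite mulrAC -mulrA gtr_pMr// ltr_pdivrMr ?mul1r ?ltrDl// ltr_wpDl.
pose g x := lim ((fun f : bop X Y => f x) @ F).
have lg : linear g.
  move=> a x y; rewrite /g.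
  apply: cvg_lim => //.
  rewrite (_ : (fun f : bop X Y => f _) = fun f => a *: f x + f y).
    by apply: cvgD; [apply: cvgZl_tmp|]; exact: cx.
  by apply/funext => f; rewrite linearP.
have gA e (e0 : 0 < e) A : F A -> (forall f h, A f -> A h -> `|f - h| < e) ->
    forall f x, A f -> `|f x - g x| <= e * `|x|.
  move=> FA hA f x Af.
  have : (fun h : bop X Y => `|f x - h x|) @ F --> `|f x - g x|.
    apply: cvg_norm; apply: cvgB; [exact: cvg_cst|exact: cx].
  move/cvgr_to_le; apply; apply: filterS FA => h Ah.
  by rewrite -bopBE (le_trans (bop_normP _ _))// ler_wpM2r// ltW// hA.
have bg : exists C : R, forall x, `|g x| <= C * `|x|.
  have [A FA hA] := cF 1 ltr01.
  have [f Af] := filter_ex FA.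
  exists (`|f| + 1) => x.
  rewrite -(subrK (f x) (g x)) addrC (le_trans (ler_normD _ _))// mulrDl lerD//.
    exact: bop_normP.
  by rewrite distrC; apply: gA FA hA _ _ Af.
apply/cvg_ex; exists (mkbop lg bg); apply/cvgrPdist_le => /= e e0.
have [A FA hA] := cF e e0.
apply: filterS (FA) => f Af /=; rewrite distrC.
apply: bop_norm_le; first exact: ltW.
by move=> x; exact: (gA _ e0 _ FA hA).
Qed.

HB.instance Definition _ := Uniform_isComplete.Build (bop X Y) bop_complete.

End BopComplete.

Section ClosedSubspace.
Context {R : realType} (E : normedModType R).

Record closedSubspace := ClosedSubspace {
  csub_pred :> {pred E} ;
  csub_submod : submod_closed csub_pred ;
  csub_closed : closed [set` csub_pred] }.

HB.instance Definition _ (M : closedSubspace) :=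
  GRing.isSubmodClosed.Build R E (csub_pred M) (csub_submod M).

(* A closed subspace as a normed space of its own, with the induced norm. *)
Record subsp (M : closedSubspace) := Subsp {
  subsp_val :> E ; subspP : subsp_val \in M }.

Section subsp_structure.
Variable M : closedSubspace.

HB.instance Definition _ := [isSub for @subsp_val M].
HB.instance Definition _ := [Choice of subsp M by <:].
HB.instance Definition _ := [SubChoice_isSubLmodule of subsp M by <:].

Let norm_triangle (x y : subsp M) : `|val (x + y)| <= `|val x| + `|val y|.
Proof. exact: ler_normD. Qed.

Let norm_scale (a : R) (x : subsp M) : `|val (a *: x)| = `|a| * `|val x|.
Proof. exact: normrZ. Qed.

Let norm_eq0 (x : subsp M) : `|val x| = 0 -> x = 0.
Proof. by move=> /eqP; rewrite normr_eq0 => /eqP x0; apply: val_inj. Qed.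

HB.instance Definition _ :=
  Lmodule_isNormed.Build R (subsp M) norm_triangle norm_scale norm_eq0.

Lemma subsp_normE (x : subsp M) : `|x| = `|val x|. Proof. by []. Qed.

Lemma subsp_incl_linear : linear (@subsp_val M). Proof. by []. Qed.

Lemma subsp_incl_bounded :
  exists C : R, forall x : subsp M, `|subsp_val x| <= C * `|x|.
Proof. by exists 1 => x; rewrite mul1r. Qed.

Definition subsp_incl : bop (subsp M) E :=
  mkbop subsp_incl_linear subsp_incl_bounded.

End subsp_structure.

Lemma closure_normP (A : set E) x :
  closure A x <-> forall e, 0 < e -> exists2 y, A y & `|x - y| < e.
Proof.
split=> [Ax e e0|H B].
  have [y [Ay]] := Ax _ (nbhsx_ballx x e e0).
  by rewrite -ball_normE /= => xy; exists y.
move=> /nbhs_ballP[e /= e0 eB]; have [y Ay xy] := H e e0.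
by exists y; split=> //; apply: eB; rewrite -ball_normE.
Qed.

Lemma closure_submod (A : set E) :
  submod_closed [in A] -> submod_closed [in closure A].
Proof.
move=> [A0 AD]; split.
  by rewrite inE; apply: subset_closure; move: A0; rewrite inE.
move=> a u v; rewrite !inE => /closure_normP Au /closure_normP Av.
apply/closure_normP => e e0.
have d0 : 0 < `|a| + 1 by rewrite ltr_wpDl.
have [|u' Au' uu'] := Au (e / 2 / (`|a| + 1)); first by rewrite !divr_gt0.
have [|v' Av' vv'] := Av (e / 2); first by rewrite divr_gt0.
exists (a *: u' + v').
  by have := AD a u' v'; rewrite !inE; apply.
rewrite opprD addrACA -scalerBr (splitr e).
rewrite (le_lt_trans (ler_normD _ _))// ler_ltD// normrZ.
rewrite (@le_trans _ _ (`|a| * (e / 2 / (`|a| + 1))))// ?ler_wpM2l// ?ltW//.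
by rewrite mulrA ltr_pdivrMr// mulrC ltr_pM2l ?ltrDl// divr_gt0.
Qed.

Lemma set_closed_subproof (A : set E) : closed A -> closed [set` [in A]].
Proof. by move=> cA; rewrite (_ : [set` _] = A)//; apply/seteqP; split=> x /=; rewrite inE. Qed.

Definition mk_closedSubspace (A : set E) (sA : submod_closed [in A])
    (cA : closed A) : closedSubspace :=
  ClosedSubspace sA (set_closed_subproof cA).

(* The closed linear span: the smallest closed linear subspace containing G. *)
Definition closed_span_set (G : set E) : set E :=
  smallest (fun A => submod_closed [in A] /\ closed A) G.

Lemma closed_span_submod (G : set E) : submod_closed [in closed_span_set G].
Proof.
split; first by rewrite inE => A [[[A0 _] _] _]; move: A0; rewrite inE.
move=> a u v; rewrite !inE => Gu Gv A HA; have [[[_ AD] _] _] := HA.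
by have := AD a u v; rewrite !inE; apply; [exact: Gu|exact: Gv].
Qed.

Lemma closed_span_closed (G : set E) : closed (closed_span_set G).
Proof. by apply: closed_bigI => A [[_ cA] _]. Qed.

Definition closed_span (G : set E) : closedSubspace :=
  mk_closedSubspace (@closed_span_submod G) (@closed_span_closed G).

Lemma closed_span_mem (G : set E) x : G x -> x \in closed_span G.
Proof. by move=> Gx; rewrite inE; apply: sub_gen_smallest. Qed.

End ClosedSubspace.

Section SubspComplete.
Context {R : realType} (E : completeNormedModType R) (M : closedSubspace E).

Lemma subsp_complete (F : set_system (subsp M)) :
  ProperFilter F -> cauchy F -> cvg F.
Proof.
move=> FF /cauchyP Fc.
have : cauchy ((val : subsp M -> E) @ F).
  apply/cauchyP => e e0; have [x Fx] := Fc e e0.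
  exists (val x); apply: (@filterS _ F _ (ball x e)) => // y.
  by rewrite -!ball_normE.
move=> /cauchy_cvgP/cvg_ex[l Fl].
have lM : l \in M.
  have : [set` (csub_pred M)] l.
    have := @closed_cvg _ _ F _ val _ (@csub_closed _ _ M); apply; last exact: Fl.
    by apply: (@filterS _ F _ setT) => [x _|]; [exact: subspP|exact: filterT].
  by [].
apply/cvg_ex; exists (Subsp lM); apply/cvgrPdist_lt => e e0.
by move/cvgrPdist_lt : Fl => /(_ e e0).
Qed.

HB.instance Definition _ := Uniform_isComplete.Build (subsp M) subsp_complete.

End SubspComplete.

Section HahnBanach.
Context {R : realType} (V : lmodType R).

(* Stated with <=; equality for a >= 0 is sublinearZ. *)
Definition sublinear (p : V -> R) :=
  (forall x y, p (x + y) <= p x + p y) /\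
  (forall (a : R) x, 0 <= a -> p (a *: x) <= a * p x).

Lemma sublinearZ p (a : R) x : sublinear p -> 0 <= a -> p (a *: x) = a * p x.
Proof.
move=> [pD pZ] a0; apply/le_anti/andP; split; first exact: pZ.
have [->|an0] := eqVneq a 0.
  have := pD (0 *: x) (0 *: x).
  by rewrite -scalerDl addr0 mul0r lerDl.
have a_gt0 : 0 < a by rewrite lt_def an0.
rewrite -ler_pdivlMl//; apply: le_trans (pZ _ _ _); last by rewrite invr_ge0.
by rewrite scalerA mulVf// scale1r.
Qed.

Lemma sublinear0 p : sublinear p -> p 0 = 0.
Proof. by move=> sp; rewrite -(scale0r 0) sublinearZ// mul0r. Qed.

Lemma sublinearN p x : sublinear p -> - p (- x) <= p x.
Proof.
by move=> sp; rewrite lerNl -subr_ge0 opprK addrC -(sublinear0 sp) -{1}(subrr x) sp.1.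
Qed.

Definition sublinear_shift (q : V -> R) y x : R :=
  inf [set q (x + t *: y) - t * q y | t in [set t | 0 <= t]].

Lemma sublinear_shift_le q y x t : sublinear q -> 0 <= t ->
  sublinear_shift q y x <= q (x + t *: y) - t * q y.
Proof.
move=> sq t0; apply: ge_inf; last by exists t.
exists (- q (- x)) => _ [s /= s0 <-].
rewrite lerBrDr addrC -sublinearZ// lerBlDr.
by apply: le_trans (sq.1 _ _); rewrite addrC addrA addNr add0r.
Qed.

Lemma sublinear_shift_sublinear q y : sublinear q ->
  sublinear (sublinear_shift q y).
Proof.
move=> sq; split=> [x x'|a x].
  rewrite -lerBlDr; apply: lb_le_inf.
    by exists (q (x + 0 *: y) - 0 * q y); exists 0 => /=.
  move=> _ [t /= t0 <-]; rewrite lerBlDr -lerBlDl; apply: lb_le_inf.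
    by exists (q (x' + 0 *: y) - 0 * q y); exists 0 => /=.
  move=> _ [s /= s0 <-]; rewrite lerBlDl.
  apply: le_trans (sublinear_shift_le _ _ sq (addr_ge0 t0 s0)) _.
  by rewrite scalerDl mulrDl addrACA opprD [leRHS]addrACA lerD2r sq.1.
rewrite le_eqVlt => /predU1P[<-|a0].
  apply: le_trans (sublinear_shift_le _ _ sq (lexx 0)) _.
  by rewrite !scale0r !mul0r addr0 subr0 sublinear0.
rewrite -ler_pdivrMl//; apply: lb_le_inf.
  by exists (q (x + 0 *: y) - 0 * q y); exists 0 => /=.
move=> _ [t /= t0 <-]; rewrite ler_pdivrMl//.
apply: le_trans (sublinear_shift_le _ _ sq (mulr_ge0 (ltW a0) t0)) _.
by rewrite -scalerA -scalerDr (sublinearZ _ sq (ltW a0)) mulrBr mulrA.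
Qed.

Lemma sublinear_linear_le (p : V -> R) : sublinear p ->
  exists f : V -> R, linear (f : V -> R^o) /\ forall x, f x <= p x.
Proof.
move=> sp.
pose T := {q : V -> R | sublinear q /\ forall x, q x <= p x}.
pose r (q1 q2 : T) := `[< forall x, sval q2 x <= sval q1 x >].
have [||||q qmin] := @Zorn T r.
- by move=> q; apply/asboolP.
- move=> q1 q2 q3 /asboolP h1 /asboolP h2; apply/asboolP => x.
  exact: le_trans (h2 x) (h1 x).
- move=> [q1 h1] [q2 h2] /asboolP /= h /asboolP /= h'; apply: eq_exist.
  by apply/funext => x; apply/le_anti; rewrite h h'.
- move=> A totA; have [[q0 Aq0]|A0] := pselect (A !=set0); last first.
    by exists (exist _ p (conj sp (fun x => lexx (p x)))) => s As; case: A0; exists s.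
  pose m x := inf [set sval q x | q in A].
  have mle q x : A q -> m x <= sval q x.
    move=> Aq; apply: ge_inf; last by exists q.
    exists (- p (- x)) => _ [q' Aq' <-].
    apply: le_trans (sublinearN _ (svalP q').1).
    by rewrite lerN2 (svalP q').2.
  have lem x c : (forall q, A q -> c <= sval q x) -> c <= m x.
    move=> h; apply: lb_le_inf; first by exists (sval q0 x), q0.
    by move=> _ [q Aq <-]; exact: h.
  have sm : sublinear m.
    split=> [x y|a x].
      rewrite -lerBlDr; apply: (lem x) => q1 Aq1; rewrite lerBlDr -lerBlDl.
      apply: (lem y) => q2 Aq2; rewrite lerBlDl.
      have [/asboolP h|/asboolP h] := totA _ _ Aq1 Aq2.
        apply: le_trans (mle _ _ Aq2) _.
        by apply: le_trans ((svalP q2).1.1 _ _) _; rewrite lerD2r h.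
      apply: le_trans (mle _ _ Aq1) _.
      by apply: le_trans ((svalP q1).1.1 _ _) _; rewrite lerD2l h.
    rewrite le_eqVlt => /predU1P[<-|a0].
      apply: le_trans (mle _ _ Aq0) _.
      by rewrite scale0r mul0r sublinear0//; exact: (svalP q0).1.
    rewrite -ler_pdivrMl//; apply: (lem x) => q Aq; rewrite ler_pdivrMl//.
    apply: le_trans (mle _ _ Aq) _.
    by rewrite (svalP q).1.2// ltW.
  have mp x : m x <= p x by apply: le_trans (mle _ _ Aq0) _; exact: (svalP q0).2.
  by exists (exist _ m (conj sm mp)) => q Aq; apply/asboolP => x /=; exact: mle.
have [sq qp] := svalP q; set f := sval q in sq qp; exists f; split => //.
have fB x y : f x + f y <= f (x + y).
  pose g := sublinear_shift f y.
  have sg : sublinear g by exact: sublinear_shift_sublinear.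
  have gf z : g z <= f z.
    apply: le_trans (sublinear_shift_le _ _ sq (lexx 0)) _.
    by rewrite scale0r mul0r addr0 subr0.
  have gp z : g z <= p z by exact: le_trans (gf z) (qp z).
  have /(congr1 sval) /= : exist _ g (conj sg gp) = q.
    by apply: qmin; apply/asboolP.
  move=> /(congr1 (@^~ x)) gE; rewrite -lerBrDr.
  have -> : f x = g x by rewrite gE.
  apply: le_trans (sublinear_shift_le _ _ sq ler01) _.
  by rewrite scale1r mul1r.
have fD x y : f (x + y) = f x + f y by apply/le_anti; rewrite fB sq.1.
have fN x : f (- x) = - f x.
  by apply/eqP; rewrite -subr_eq0 opprK -fD addNr sublinear0.
move=> a x y; rewrite fD; congr (_ + _).
have [a0|/ltW a0] := leP 0 a; first exact: sublinearZ.
by rewrite -[a]opprK scaleNr fN sublinearZ ?oppr_ge0// -mulNr.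
Qed.

Theorem Hahn_Banach (p : V -> R) (v : V) : sublinear p ->
  exists f : V -> R, [/\ linear (f : V -> R^o), forall x, f x <= p x & f v = p v].
Proof.
move=> sp.
have [f [lf fg]] := sublinear_linear_le (sublinear_shift_sublinear v sp).
have gp z : sublinear_shift p v z <= p z.
  apply: le_trans (sublinear_shift_le _ _ sp (lexx 0)) _.
  by rewrite scale0r mul0r addr0 subr0.
exists f; split=> // [x|]; first exact: le_trans (gp x).
apply/le_anti/andP; split; first exact: le_trans (gp v).
pose F : {linear V -> R^o} := HB.pack f (GRing.isLinear.Build R V R^o *:%R f lf).
have : f (- v) = - f v by exact: (linearN F).
move/(congr1 -%R); rewrite opprK => <-.
rewrite lerNr; apply: le_trans (fg _) _.
apply: le_trans (sublinear_shift_le _ _ sp ler01) _.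
by rewrite scale1r mul1r addNr sublinear0// sub0r.
Qed.

End HahnBanach.

Section QuotientSpace.
Context {R : realType} (E : normedModType R) (M : closedSubspace E).
Local Open Scope quotient_scope.

Definition quotsp := Quotient.quot (csub_pred M).

HB.instance Definition _ := GRing.Zmodule.on quotsp.

Definition quotsp_pi (x : E) : quotsp := \pi x.

Lemma quotsp_piD x y : quotsp_pi (x + y) = quotsp_pi x + quotsp_pi y.
Proof. by rewrite /quotsp_pi; apply: raddfD. Qed.

Lemma quotsp_piP x y : (quotsp_pi x = quotsp_pi y) <-> (x - y \in M).
Proof.
by rewrite [x - y \in M]Quotient.idealrBE; split=> h; [apply/eqP; exact: h|move/eqP: h].
Qed.

Lemma quotsp_surj (q : quotsp) : exists x, quotsp_pi x = q.
Proof. by exists (repr q); rewrite /quotsp_pi reprK. Qed.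

Definition quotsp_scale (a : R) (q : quotsp) : quotsp :=
  quotsp_pi (a *: (repr q)).

Lemma quotsp_piZ a x : quotsp_pi (a *: x) = quotsp_scale a (quotsp_pi x).
Proof.
apply/quotsp_piP; rewrite -scalerBr rpredZ//.
by apply/quotsp_piP; rewrite /quotsp_pi reprK.
Qed.

Lemma quotsp_scaleA a b q :
  quotsp_scale a (quotsp_scale b q) = quotsp_scale (a * b) q.
Proof. by have [x <-] := quotsp_surj q; rewrite -!quotsp_piZ scalerA. Qed.

Lemma quotsp_scale1 : left_id 1 quotsp_scale.
Proof. by move=> q; have [x <-] := quotsp_surj q; rewrite -!quotsp_piZ scale1r. Qed.

Lemma quotsp_scaleDr : right_distributive quotsp_scale +%R.
Proof.
move=> a q r; have [x <-] := quotsp_surj q; have [y <-] := quotsp_surj r.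
by rewrite -quotsp_piD -!quotsp_piZ scalerDr quotsp_piD.
Qed.

Lemma quotsp_scaleDl q : {morph quotsp_scale^~ q : a b / a + b}.
Proof.
move=> a b; have [x <-] := quotsp_surj q.
by rewrite -!quotsp_piZ scalerDl quotsp_piD.
Qed.

HB.instance Definition _ := GRing.Zmodule_isLmodule.Build R quotsp
  quotsp_scaleA quotsp_scale1 quotsp_scaleDr quotsp_scaleDl.

Lemma quotsp_pi_linear : linear quotsp_pi.
Proof. by move=> a x y; rewrite quotsp_piD quotsp_piZ. Qed.

HB.instance Definition _ :=
  GRing.isLinear.Build R E quotsp *:%R quotsp_pi quotsp_pi_linear.

(* The quotient norm, i.e. the distance to M. *)
Definition quotsp_norm (q : quotsp) : R :=
  inf [set `|x| | x in [set x | quotsp_pi x = q]].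

Let has_inf_norm (q : quotsp) :
  has_inf [set `|x| | x in [set x | quotsp_pi x = q]].
Proof.
split; last by exists 0 => _ [x _ <-].
by have [x xq] := quotsp_surj q; exists `|x|, x.
Qed.

Let norm_le x : quotsp_norm (quotsp_pi x) <= `|x|.
Proof. by apply: (ge_inf (has_inf_norm _).2); exists x. Qed.

Let le_norm c q : (forall x, quotsp_pi x = q -> c <= `|x|) -> c <= quotsp_norm q.
Proof.
move=> h; apply: (lb_le_inf (has_inf_norm q).1).
by move=> _ [x /= xq <-]; exact: h.
Qed.

Let norm_lt q e : 0 < e -> exists2 x, quotsp_pi x = q & `|x| < quotsp_norm q + e.
Proof.
move=> e0; have [_ [x /= xq <-] xe] := inf_adherent e0 (has_inf_norm q).
by exists x.
Qed.

Let norm_triangle q r : quotsp_norm (q + r) <= quotsp_norm q + quotsp_norm r.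
Proof.
rewrite -lerBlDr; apply: le_norm => x <-; rewrite lerBlDr -lerBlDl.
apply: le_norm => y <-; rewrite lerBlDl -quotsp_piD.
exact: le_trans (norm_le _) (ler_normD _ _).
Qed.

Let norm_scaleW (a : R) q : quotsp_norm (a *: q) <= `|a| * quotsp_norm q.
Proof.
have [->|a0] := eqVneq a 0.
  rewrite scale0r normr0 mul0r -(linear0 quotsp_pi).
  by apply: le_trans (norm_le _) _; rewrite normr0.
rewrite -ler_pdivrMl ?normr_gt0//; apply: le_norm => x <-.
rewrite ler_pdivrMl ?normr_gt0// -normrZ -linearZ; exact: norm_le.
Qed.

Let norm_scale (a : R) q : quotsp_norm (a *: q) = `|a| * quotsp_norm q.
Proof.
apply/le_anti/andP; split => //.
have [->|a0] := eqVneq a 0.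
  by rewrite normr0 mul0r; apply: le_norm => x _.
have := norm_scaleW a^-1 (a *: q).
by rewrite scalerA mulVf// scale1r normfV ler_pdivlMl// normr_gt0.
Qed.

Let norm_eq0 q : quotsp_norm q = 0 -> q = 0.
Proof.
have [x <-] := quotsp_surj q => x0; rewrite -(linear0 quotsp_pi).
apply/quotsp_piP; rewrite subr0.
suff : closure [set` (csub_pred M)] x.
  by rewrite -(closure_id _).1//; exact: csub_closed.
apply/closure_normP => e e0; have [y yx] := norm_lt (quotsp_pi x) e0.
rewrite x0 add0r => ye; exists (x - y).
  by apply/quotsp_piP.
by rewrite opprB addrC subrK.
Qed.

HB.instance Definition _ :=
  Lmodule_isNormed.Build R quotsp norm_triangle norm_scale norm_eq0.

Lemma quotsp_normE (q : quotsp) :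
  `|q| = inf [set `|x| | x in [set x | quotsp_pi x = q]].
Proof. by []. Qed.

Lemma quotsp_pi_norm_le x : `|quotsp_pi x| <= `|x|.
Proof. exact: norm_le. Qed.

Lemma quotsp_lift q (e : R) : 0 < e ->
  exists2 x, quotsp_pi x = q & `|x| < `|q| + e.
Proof. exact: norm_lt. Qed.

Lemma quotsp_pi_bounded :
  exists C : R, forall x : E, `|quotsp_pi x| <= C * `|x|.
Proof. by exists 1 => x; rewrite mul1r quotsp_pi_norm_le. Qed.

Definition quotsp_proj : bop E quotsp :=
  mkbop quotsp_pi_linear quotsp_pi_bounded.

End QuotientSpace.

Section QuotientComplete.
Context {R : realType} (E : completeNormedModType R) (M : closedSubspace E).

Lemma quotsp_complete (F : set_system (quotsp M)) :
  ProperFilter F -> cauchy F -> cvg F.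
Proof.
move=> FF /cauchyP Fc.
pose h n : R := 2^-1 ^+ n.
have h0 n : 0 < h n by rewrite exprn_gt0// invr_gt0.
have hS n : h n.+1 <= h n by rewrite /h exprS ger_pMl ?exprn_gt0// invf_le1// ler1n.
pose q n := sval (cid (Fc (h n) (h0 n))).
have Fq n : F (ball (q n) (h n)) by exact: svalP (cid (Fc (h n) (h0 n))).
have qq n : `|q n.+1 - q n| < 2 * h n.
  have [r [r1 r2]] := filter_ex (filterI (Fq n) (Fq n.+1)).
  move: r1 r2; rewrite -!ball_normE /= => r1 r2.
  rewrite -(subrK r (q n.+1)) -addrA (le_lt_trans (ler_normD _ _))//.
  rewrite mulrDl mul1r ltrD// 1?distrC//.
  by rewrite distrC (lt_le_trans r2)// hS.
have lift n := quotsp_lift (q n.+1 - q n) (h0 n).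
pose d n := s2val (cid2 (lift n)).
have dq n : quotsp_pi M (d n) = q n.+1 - q n by exact: s2valP (cid2 (lift n)).
have dn n : `|d n| <= geometric 3 2^-1 n.
  have := s2valP' (cid2 (lift n)); rewrite -/(d n) => /ltW /le_trans; apply.
  rewrite /= -/(h n) (_ : 3 * h n = 2 * h n + h n).
    by rewrite lerD2r ltW.
  by ring.
have cd : cvgn (series d).
  apply: normed_cvg; apply: (series_le_cvg _ _ dn) => [//|n|].
    by rewrite /= mulr_ge0// ltW// h0.
  by apply: is_cvg_geometric_series; rewrite ger0_norm// invf_lt1// ltr1n.
pose s := limn (series d).
have qn n : q n = q 0 + quotsp_pi M (series d n).
  elim: n => [|n IH]; first by rewrite /series /= big_geq// linear0 addr0.
  by rewrite seriesSr quotsp_piD addrA -IH dq addrC subrK.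
apply/cvg_ex; exists (q 0 + quotsp_pi M s); apply/cvgrPdist_lt => /= e e0.
have e2 : 0 < e / 2 by rewrite divr_gt0.
have /cvgrPdist_lt/(_ _ e2) ds : series d @ \oo --> s by [].
have /cvgrPdist_lt/(_ _ e2) hs : h @ \oo --> 0.
  rewrite (_ : h = geometric 1 2^-1); last by apply/funext => n; rewrite /= mul1r.
  by apply: cvg_geometric; rewrite ger0_norm// invf_lt1// ltr1n.
have [n [/= dsn hn]] := filter_ex (filterI ds hs).
apply: filterS (Fq n) => r; rewrite -ball_normE /= => rn.
rewrite -(subrK (q n) (q 0 + quotsp_pi M s)) -[X in `|X|]addrA (splitr e).
rewrite (le_lt_trans (ler_normD _ _))// ltrD//.
  rewrite (qn n) opprD addrACA subrr add0r -linearB.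
  exact: le_lt_trans (quotsp_pi_norm_le _ _) dsn.
by apply: lt_trans rn _; move: hn; rewrite sub0r normrN gtr0_norm.
Qed.

HB.instance Definition _ := Uniform_isComplete.Build (quotsp M) quotsp_complete.

End QuotientComplete.

Section BoundedOperatorTheory.
Context {R : realType}.

Section Composition.
Context {X Y Z : normedModType R}.

Lemma bcomp_linear (g : bop Y Z) (f : bop X Y) : linear (g \o f).
Proof. by move=> a x y /=; rewrite !linearP. Qed.

Lemma bcomp_le (g : bop Y Z) (f : bop X Y) x :
  `|(g \o f) x| <= `|g| * `|f| * `|x|.
Proof.
rewrite -mulrA; apply: le_trans (bop_normP _ _) _.
by rewrite ler_wpM2l// bop_normP.
Qed.

Definition bcomp (g : bop Y Z) (f : bop X Y) : bop X Z :=
  mkbop (bcomp_linear g f) (ex_intro _ _ (bcomp_le g f)).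

Lemma bcomp_norm (g : bop Y Z) (f : bop X Y) : `|bcomp g f| <= `|g| * `|f|.
Proof. by apply: bop_norm_le => [|x]; [rewrite mulr_ge0|exact: bcomp_le]. Qed.

Lemma postcomp_linear (g : bop Y Z) : linear (bcomp g).
Proof. by move=> a f h; apply: bopE => x; rewrite /= linearP. Qed.

Definition postcomp (g : bop Y Z) : bop (bop X Y) (bop X Z) :=
  mkbop (postcomp_linear g) (ex_intro _ _ (bcomp_norm g)).

Lemma precomp_linear (f : bop X Y) : linear (bcomp^~ f : bop Y Z -> bop X Z).
Proof. by move=> a g h; apply: bopE. Qed.

Lemma precomp_le (f : bop X Y) (g : bop Y Z) : `|bcomp g f| <= `|f| * `|g|.
Proof. by rewrite mulrC bcomp_norm. Qed.

Definition precomp (f : bop X Y) : bop (bop Y Z) (bop X Z) :=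
  mkbop (precomp_linear f) (ex_intro _ _ (precomp_le f)).

End Composition.

Lemma bopB (X Y : normedModType R) (f : bop X Y) x y : f (x - y) = f x - f y.
Proof. exact: linearB. Qed.

Lemma bopDZ (X Y : normedModType R) (f : bop X Y) a x y :
  f (a *: x + y) = a *: f x + f y.
Proof. exact: linearP. Qed.

Lemma isometric_range_closed (X : completeNormedModType R) (Y : normedModType R)
  (f : bop X Y) : (forall x, `|f x| = `|x|) -> closed (range f).
Proof.
move=> fi; rewrite closure_id; apply/seteqP; split; first exact: subset_closure.
move=> y /closure_normP fy.
pose F := filter_from [set e : R | 0 < e] (fun e => [set x | `|y - f x| < e]).
have FF : ProperFilter F.
  apply: filter_from_proper; last first.
    by move=> e /= e0; have [_ [x _ <-] xe] := fy e e0; exists x.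
  apply: filter_from_filter; first by exists 1 => /=.
  move=> d e /= d0 e0; exists (Num.min d e); first by rewrite /= lt_min d0.
  by move=> x /=; rewrite lt_min => /andP.
have : cauchy F.
  apply/cauchyP => e e0.
  have [_ [x _ <-] xe] := fy (e / 2) (divr_gt0 e0 (ltr0Sn _ 1)).
  exists x; exists (e / 2); first by rewrite /= divr_gt0.
  move=> z /= ze; rewrite -ball_normE /= -fi bopB.
  rewrite -(subrK y (f x)) -addrA (splitr e) (le_lt_trans (ler_normD _ _))//.
  by rewrite ltrD// distrC.
move=> /cauchy_cvgP/cvg_ex[x Fcvg].
have Fx e : 0 < e -> F [set z | `|x - z| < e].
  by move=> e0; apply: Fcvg; apply/nbhs_ballP; exists e => //= z; rewrite -ball_normE.
exists x => //; apply/eqP; rewrite -subr_eq0 -normr_le0.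
apply/ler_addgt0Pr => e e0; rewrite add0r.
have e2 : 0 < e / 2 by rewrite divr_gt0.
have Fe : F [set z | `|y - f z| < e / 2] by exists (e / 2).
have [z [/= xz yz]] := filter_ex (filterI (Fx _ e2) Fe).
rewrite -(subrK (f z) (f x)) -addrA (splitr e) (le_trans (ler_normD _ _))//.
by rewrite lerD// ltW// ?(distrC (f z))// -bopB fi.
Qed.

End BoundedOperatorTheory.

Section Duality.
Context {R : realType}.
Local Notation banach := (completeNormedModType R).

Definition dual (X : normedModType R) : banach := bop X R^o.

Definition bidual (X : normedModType R) : banach := dual (dual X).

Lemma bidual_ev_linear (X : normedModType R) (x : X) :
  linear (fun f : dual X => f x : R^o).
Proof. by []. Qed.

Lemma bidual_ev_le (X : normedModType R) (x : X) (f : dual X) :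
  `|f x| <= `|x| * `|f|.
Proof. by rewrite mulrC; exact: bop_normP. Qed.

Definition bidual_ev (X : normedModType R) (x : X) : bidual X :=
  mkbop (@bidual_ev_linear X x) (ex_intro _ _ (@bidual_ev_le X x)).

Lemma bidual_emb_linear (X : normedModType R) : linear (@bidual_ev X).
Proof. by move=> a x y; apply: bopE => f; rewrite /= linearP. Qed.

Lemma bidual_emb_le (X : normedModType R) (x : X) : `|bidual_ev x| <= 1 * `|x|.
Proof. by rewrite mul1r; apply: bop_norm_le => // f; apply: (@bidual_ev_le X x f). Qed.

Definition bidual_emb (X : normedModType R) : bop X (bidual X) :=
  mkbop (@bidual_emb_linear X) (ex_intro _ _ (@bidual_emb_le X)).

Lemma norming_functional (X : normedModType R) (x : X) :
  exists2 f : dual X, `|f| <= 1 & f x = `|x|.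
Proof.
have sn : sublinear (fun x : X => `|x|).
  split=> [y z|a y a0]; first exact: ler_normD.
  by rewrite normrZ ger0_norm.
have [f [lf fn fx]] := Hahn_Banach x sn.
pose F : {linear X -> R^o} := HB.pack f (GRing.isLinear.Build R X R^o *:%R f lf).
have fb y : `|f y : R^o| <= 1 * `|y|.
  rewrite mul1r ler_norml fn andbT lerNl.
  have <- : f (- y) = - f y by exact: (linearN F).
  by rewrite -(normrN y).
exists (mkbop (lf : linear (f : X -> R^o)) (ex_intro _ _ fb)) => //.
exact: bop_norm_le.
Qed.

Lemma bidual_emb_norm (X : normedModType R) (x : X) : `|bidual_emb X x| = `|x|.
Proof.
apply/le_anti/andP; split; first by have := bidual_emb_le x; rewrite mul1r.
have [f f1 fx] := norming_functional x.
have -> : `|x| = `|(bidual_emb X x) f| by rewrite /= fx normr_id.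
by apply: le_trans (bop_normP _ _) _; rewrite ler_piMr.
Qed.

End Duality.

Section ClosedSpanTheory.
Context {R : realType}.

Lemma closed_span_ind (E : normedModType R) (G : set E)
    (P : set (subsp (closed_span G))) :
  (forall x (Gx : G x), P (Subsp (closed_span_mem Gx))) ->
  submod_closed [in P] -> closed P -> forall x, P x.
Proof.
move=> PG [P0 PD] cP x.
pose Q := [set y | exists2 z, P z & subsp_val z = y].
have sQ : submod_closed [in closure Q].
  apply: closure_submod; split.
    by rewrite inE; exists 0 => //; move: P0; rewrite inE.
  move=> a u v; rewrite !inE => -[u' Pu <-] [v' Pv <-].
  exists (a *: u' + v') => //.
  by have := PD a u' v'; rewrite !inE; apply.
have : closure Q (subsp_val x).
  have xG := subspP x; rewrite inE in xG; apply: xG; split.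
    by split=> //; exact: closed_closure.
  by move=> y Gy; apply: subset_closure; exists (Subsp (closed_span_mem Gy)).
move=> /closure_normP Qx; rewrite (closure_id P).1//; apply/closure_normP.
by move=> e /Qx[_ [z Pz <-] xz]; exists z.
Qed.

Lemma closed_span_ext (E F : normedModType R) (G : set E)
    (f g : bop (subsp (closed_span G)) F) :
  (forall x (Gx : G x), f (Subsp (closed_span_mem Gx)) =
                        g (Subsp (closed_span_mem Gx))) -> f = g.
Proof.
move=> fg; apply: bopE; apply: closed_span_ind => //.
  split; rewrite ?inE; first by rewrite !linear0.
  by move=> a u v; rewrite !inE => fu fv; rewrite !bopDZ fu fv.
rewrite closure_id; apply/seteqP; split; first exact: subset_closure.
move=> u /closure_normP fgu; apply/eqP; rewrite -subr_eq0 -normr_le0.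
rewrite -bopBE; apply/ler_addgt0Pr => e e0; rewrite add0r.
have [|v fgv uv] := fgu (e / (`|f - g| + 1)).
  by rewrite divr_gt0// ltr_wpDl.
have -> : (f - g) u = (f - g) (u - v) by rewrite bopB !bopBE fgv subrr subr0.
apply: le_trans (bop_normP _ _) _.
apply: (@le_trans _ _ (`|f - g| * (e / (`|f - g| + 1)))).
  by rewrite ler_wpM2l// ltW.
by rewrite mulrA ler_pdivrMr ?ltr_wpDl// mulrC ler_pM2l// lerDl.
Qed.

End ClosedSpanTheory.

Section InjectiveTensor.
Context {R : realType} (X Z : completeNormedModType R).

Lemma itens_op_linear (x : X) (z : Z) : linear (fun f : dual X => f x *: z).
Proof. by move=> a f g; rewrite scalerDl scalerA. Qed.

Lemma itens_op_le (x : X) (z : Z) (f : dual X) :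
  `|f x *: z| <= `|x| * `|z| * `|f|.
Proof.
by rewrite normrZ mulrAC ler_wpM2r// mulrC; exact: (bop_normP f x).
Qed.

(* The elementary tensor x (x) z, viewed as the operator f |-> f(x) z. *)
Definition itens_op (x : X) (z : Z) : bop (dual X) Z :=
  mkbop (@itens_op_linear x z) (ex_intro _ _ (@itens_op_le x z)).

(* The injective tensor product is realized as the closed linear span in
   L(X^*, Z) of the elementary tensors. That the operator norm is the injective
   norm on finite sums of elementary tensors is itens_normE. *)
Definition itens_space : closedSubspace (bop (dual X) Z) :=
  closed_span [set itens_op p.1 p.2 | p in [set: X * Z]].

Definition itens : completeNormedModType R := subsp itens_space.

Definition itens_mk (x : X) (z : Z) : itens :=
  Subsp (closed_span_mem (imageP (fun p => itens_op p.1 p.2) (I : setT (x, z)))).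

Lemma itens_normE (s : seq (X * Z)) :
  `|\sum_(p <- s) itens_mk p.1 p.2| =
  sup [set `|\sum_(p <- s) fg.1 p.1 * fg.2 p.2| | fg in
         [set fg : dual X * dual Z | `|fg.1| <= 1 /\ `|fg.2| <= 1]].
Proof.
have sumE (f : dual X) : subsp_val (\sum_(p <- s) itens_mk p.1 p.2) f =
    \sum_(p <- s) f p.1 *: p.2.
  elim/big_rec2 : _ => [|p z u _ <-]; first exact: bop0E.
  by [].
set u := \sum_(p <- s) _.
have uE (f : dual X) (g : dual Z) :
    \sum_(p <- s) f p.1 * g p.2 = g (subsp_val u f).
  rewrite sumE linear_sum; apply: eq_bigr => p _.
  by rewrite linearZ.
have ub : has_sup [set `|\sum_(p <- s) fg.1 p.1 * fg.2 p.2| | fg in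
         [set fg : dual X * dual Z | `|fg.1| <= 1 /\ `|fg.2| <= 1]].
  split; first by exists `|\sum_(p <- s) (0 : dual X) p.1 * (0 : dual Z) p.2|,
    (0, 0) => //=; rewrite !normr0.
  exists `|u| => _ [[f g] /= [f1 g1] <-]; rewrite uE.
  apply: le_trans (bop_normP _ _) _.
  apply: le_trans (ler_piMl _ g1) _ => //.
  by apply: le_trans (bop_normP _ _) _; rewrite subsp_normE ler_piMr.
apply/le_anti/andP; split; last first.
  apply: ge_sup; first exact: ub.1.
  move=> _ [[f g] /= [f1 g1] <-]; rewrite uE.
  apply: le_trans (bop_normP _ _) _.
  apply: le_trans (ler_piMl _ g1) _ => //.
  by apply: le_trans (bop_normP _ _) _; rewrite subsp_normE ler_piMr.
rewrite subsp_normE bop_normE; apply: ge_sup.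
  by exists `|subsp_val u 0|, 0 => //=; rewrite normr0.
move=> _ [f /= f1 <-].
have [g g1 gE] := norming_functional (subsp_val u f).
apply: (ub_le_sup ub.2); exists (f, g) => //=.
by rewrite uE gE normr_id.
Qed.

End InjectiveTensor.

Section ProjectiveTensor.
Context {R : realType} (X Y : completeNormedModType R).

Lemma ptens_fun_linear (x : X) (y : Y) :
  linear (fun S : bop X (dual Y) => S x y : R^o).
Proof. by move=> a S T; rewrite !bopDE !bopZE. Qed.

Lemma ptens_fun_le (x : X) (y : Y) (S : bop X (dual Y)) :
  `|S x y| <= `|x| * `|y| * `|S|.
Proof.
apply: le_trans (bop_normP (S x) y) _.
by rewrite mulrAC ler_wpM2r// mulrC; exact: (bop_normP S x).
Qed.

Definition ptens_fun (x : X) (y : Y) : dual (bop X (dual Y)) :=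
  mkbop (@ptens_fun_linear x y) (ex_intro _ _ (@ptens_fun_le x y)).

(* The projective tensor product is realized through the canonical isometry of
   the algebraic tensor product, with the projective norm, into its bidual
   L(X, Y^* )^*, where x (x) y is evaluation S |-> S(x)(y); it is the closed
   linear span of these evaluations. That the norm it carries on finite sums of
   elementary tensors is the projective norm is ptens_normE. *)
Definition ptens_space : closedSubspace (dual (bop X (dual Y))) :=
  closed_span [set ptens_fun p.1 p.2 | p in [set: X * Y]].

Definition ptens : completeNormedModType R := subsp ptens_space.

Definition ptens_mk (x : X) (y : Y) : ptens :=
  Subsp (closed_span_mem (imageP (fun p => ptens_fun p.1 p.2) (I : setT (x, y)))).

Lemma ptens_form_linear (S : bop X (dual Y)) :
  linear (fun u : ptens => subsp_val u S : R^o).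
Proof. by move=> a u v; rewrite subsp_incl_linear bopDE bopZE. Qed.

Lemma ptens_form_le (S : bop X (dual Y)) (u : ptens) :
  `|subsp_val u S| <= `|S| * `|u|.
Proof. by rewrite mulrC; exact: (bop_normP (subsp_val u) S). Qed.

(* The identification of L(X, Y^* ) with the dual of the projective tensor
   product, S |-> (x (x) y |-> S(x)(y)); it is isometric and onto
   (ptens_form_norm, ptens_form_surj). *)
Definition ptens_form (S : bop X (dual Y)) : dual ptens :=
  mkbop (@ptens_form_linear S) (ex_intro _ _ (@ptens_form_le S)).

Lemma ptens_formE (S : bop X (dual Y)) x y : ptens_form S (ptens_mk x y) = S x y.
Proof. by []. Qed.

Lemma ptens_mk_linear_r (x : X) : linear (ptens_mk x).
Proof.
by move=> a y z; apply: val_inj; apply: bopE => S; rewrite /= linearP.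
Qed.

Lemma ptens_mk_linear_l (y : Y) : linear (ptens_mk^~ y).
Proof.
by move=> a x z; apply: val_inj; apply: bopE => S; rewrite /= linearP.
Qed.

Lemma ptens_mkZl a (x : X) (y : Y) : ptens_mk (a *: x) y = a *: ptens_mk x y.
Proof. by apply: val_inj; apply: bopE => S; rewrite /= linearZ. Qed.

Lemma ptens_mkNl (x : X) (y : Y) : ptens_mk (- x) y = - ptens_mk x y.
Proof. by apply: val_inj; apply: bopE => S; rewrite /= linearN. Qed.

Lemma ptens_mk_norm_le x y : `|ptens_mk x y| <= `|x| * `|y|.
Proof. by apply: bop_norm_le => [|S]; [rewrite mulr_ge0|exact: ptens_fun_le]. Qed.

Lemma ptens_form_norm (S : bop X (dual Y)) : `|ptens_form S| = `|S|.
Proof.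
apply/le_anti/andP; split.
  by apply: bop_norm_le => // u; exact: ptens_form_le.
apply: bop_norm_le => // x; apply: bop_norm_le => [|y]; first by rewrite mulr_ge0.
rewrite -ptens_formE; apply: le_trans (bop_normP _ _) _.
by rewrite -mulrA ler_wpM2l// ptens_mk_norm_le.
Qed.

Lemma ptens_form_surj (f : dual ptens) : exists S, ptens_form S = f.
Proof.
have lf x : linear (fun y => f (ptens_mk x y) : R^o).
  by move=> a y z; rewrite ptens_mk_linear_r linearP.
have bf x y : `|f (ptens_mk x y)| <= `|f| * `|x| * `|y|.
  rewrite -mulrA; apply: le_trans (bop_normP _ _) _.
  by rewrite ler_wpM2l// ptens_mk_norm_le.
pose S0 x : dual Y := mkbop (lf x) (ex_intro _ _ (bf x)).
have lS : linear S0.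
  by move=> a x z; apply: bopE => y; rewrite /= ptens_mk_linear_l linearP.
have bS x : `|S0 x| <= `|f| * `|x|.
  by apply: bop_norm_le => [|y]; [rewrite mulr_ge0|exact: bf].
exists (mkbop lS (ex_intro _ _ bS)); apply: closed_span_ext => u Gu.
have [[x y] _ xyu] := Gu.
have -> : Subsp (closed_span_mem Gu) = ptens_mk x y by apply: val_inj.
by rewrite ptens_formE.
Qed.

End ProjectiveTensor.

Section ProjectiveNorm.
Context {R : realType} (X Y : completeNormedModType R).
Implicit Types s t : seq (X * Y).

Definition ptens_sum s : ptens X Y := \sum_(p <- s) ptens_mk p.1 p.2.

(* The quantity whose infimum over all representations is the projective norm. *)
Definition ptens_cost s : R := \sum_(p <- s) `|p.1| * `|p.2|.

Lemma ptens_sum_cat s t : ptens_sum (s ++ t) = ptens_sum s + ptens_sum t.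
Proof. exact: big_cat. Qed.

Lemma ptens_cost_cat s t : ptens_cost (s ++ t) = ptens_cost s + ptens_cost t.
Proof. exact: big_cat. Qed.

Lemma ptens_sumZ a s :
  ptens_sum [seq (a *: p.1, p.2) | p <- s] = a *: ptens_sum s.
Proof.
rewrite /ptens_sum big_map scaler_sumr; apply: eq_bigr => p _ /=.
exact: ptens_mkZl.
Qed.

Lemma ptens_costZ a s :
  ptens_cost [seq (a *: p.1, p.2) | p <- s] = `|a| * ptens_cost s.
Proof.
rewrite /ptens_cost big_map mulr_sumr; apply: eq_bigr => p _ /=.
by rewrite normrZ mulrA.
Qed.

Definition ptens_alg : {pred ptens X Y} :=
  fun u => `[< exists s, ptens_sum s = u >].

Lemma ptens_alg_submod : submod_closed ptens_alg.
Proof.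
split; first by apply/asboolP; exists [::]; rewrite /ptens_sum big_nil.
move=> a u v /asboolP[s <-] /asboolP[t <-]; apply/asboolP.
exists ([seq (a *: p.1, p.2) | p <- s] ++ t).
by rewrite ptens_sum_cat ptens_sumZ.
Qed.

HB.instance Definition _ :=
  GRing.isSubmodClosed.Build R (ptens X Y) ptens_alg ptens_alg_submod.

Record ptens_alg_type := PtensAlg {
  ptens_alg_val : ptens X Y ; _ : ptens_alg_val \in ptens_alg }.

HB.instance Definition _ := [isSub for ptens_alg_val].
HB.instance Definition _ := [Choice of ptens_alg_type by <:].
HB.instance Definition _ := [SubChoice_isSubLmodule of ptens_alg_type by <:].

Let cost_set (u : ptens X Y) := [set ptens_cost s | s in [set s | ptens_sum s = u]].
Let pi_norm (u : ptens_alg_type) : R := inf (cost_set (val u)).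

Let cost_ge0 s : 0 <= ptens_cost s.
Proof. by apply: sumr_ge0 => p _; rewrite mulr_ge0. Qed.

Let pi_norm_le (u : ptens_alg_type) s : ptens_sum s = val u ->
  pi_norm u <= ptens_cost s.
Proof.
move=> su; apply: ge_inf; last by exists s.
by exists 0 => _ [t _ <-]; exact: cost_ge0.
Qed.

Let le_pi_norm (u : ptens_alg_type) c :
  (forall s, ptens_sum s = val u -> c <= ptens_cost s) -> c <= pi_norm u.
Proof.
move=> h; apply: lb_le_inf; last by move=> _ [s /= su <-]; exact: h.
by have /asboolP[s su] := valP u; exists (ptens_cost s), s.
Qed.

Let pi_norm_sublinear : sublinear pi_norm.
Proof.
split=> [u v|a u a0].
  rewrite -lerBlDr; apply: le_pi_norm => s su; rewrite lerBlDr -lerBlDl.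
  apply: le_pi_norm => t tv; rewrite lerBlDl.
  have : ptens_sum (s ++ t) = val (u + v).
    by rewrite ptens_sum_cat su tv.
  by move/pi_norm_le; rewrite ptens_cost_cat.
move: a0; rewrite le_eqVlt => /predU1P[<-|a0].
  rewrite mul0r; apply: le_trans (@pi_norm_le _ [::] _) _.
    by rewrite scale0r /ptens_sum big_nil.
  by rewrite /ptens_cost big_nil.
rewrite -ler_pdivrMl//; apply: le_pi_norm => s su; rewrite ler_pdivrMl//.
rewrite -[a in leRHS]gtr0_norm// -ptens_costZ; apply: pi_norm_le.
by rewrite ptens_sumZ su.
Qed.

Lemma ptens_normE s : `|ptens_sum s| =
  inf [set ptens_cost t | t in [set t | ptens_sum t = ptens_sum s]].
Proof.
apply/le_anti/andP; split.
  apply: lb_le_inf; first by exists (ptens_cost s), s.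
  move=> _ [t /= <- <-]; apply: le_trans (ler_norm_sum _ _ _) _.
  by apply: ler_sum => p _; exact: ptens_mk_norm_le.
have algP t : ptens_sum t \in ptens_alg by apply/asboolP; exists t.
have mkP x y : ptens_mk x y \in ptens_alg.
  by apply/asboolP; exists [:: (x, y)]; rewrite /ptens_sum big_seq1.
pose U t : ptens_alg_type := PtensAlg (algP t).
pose m x y : ptens_alg_type := PtensAlg (mkP x y).
rewrite -[leLHS]/(pi_norm (U s)).
have [f [lf fn fs]] := Hahn_Banach (U s) pi_norm_sublinear.
pose F : {linear ptens_alg_type -> R^o} :=
  HB.pack f (GRing.isLinear.Build R ptens_alg_type R^o *:%R f lf).
have fb x y : `|f (m x y) : R^o| <= `|x| * `|y|.
  have h x' : f (m x' y) <= `|x'| * `|y|.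
    apply: le_trans (fn _) _.
    have := @pi_norm_le (m x' y) [:: (x', y)].
    by rewrite /ptens_sum /ptens_cost !big_seq1; apply.
  rewrite ler_norml h andbT lerNl.
  have <- : f (m (- x) y) = - f (m x y).
    rewrite -[RHS](linearN F); congr f; apply: val_inj => /=.
    exact: ptens_mkNl.
  by rewrite -(normrN x).
have lr x : linear (fun y => f (m x y) : R^o).
  move=> a y z; rewrite -lf; congr f; apply: val_inj => /=.
  exact: ptens_mk_linear_r.
pose S0 x : dual Y := mkbop (lr x) (ex_intro _ _ (fb x)).
have lS : linear S0.
  move=> a x z; apply: bopE => y; rewrite bopDE bopZE.
  rewrite -[RHS]lf; congr f; apply: val_inj => /=.
  exact: ptens_mk_linear_l.
have bS x : `|S0 x| <= 1 * `|x|.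
  by rewrite mul1r; apply: bop_norm_le => // y; exact: fb.
pose S := mkbop lS (ex_intro _ _ bS).
have S1 : `|S| <= 1 by apply: bop_norm_le.
rewrite -fs (_ : f (U s) = ptens_form S (ptens_sum s)); last first.
  have -> : U s = \sum_(p <- s) m p.1 p.2.
    apply: val_inj; rewrite /= /ptens_sum.
    by elim/big_rec2 : _ => // p u v _ ->.
  rewrite [LHS](linear_sum F) /ptens_sum linear_sum.
  by apply: eq_bigr.
apply: le_trans (ler_norm _) _; apply: le_trans (bop_normP _ _) _.
by rewrite ler_piMl// ptens_form_norm.
Qed.

End ProjectiveNorm.

Section CanonicalMap.
Context {R : realType} (X Y : completeNormedModType R).

(* On v in the projective tensor product of X^* and Y^*, seen as a functional
   on L(X^*, Y^** ), and u : X^* -> Y in the injective tensor product, this is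
   v evaluated at u followed by the embedding of Y into Y^**. It is the only
   bounded operator with the value of GhatE on elementary tensors
   (Ghat_unique). *)
Definition Ghat : bop (ptens (dual X) (dual Y)) (dual (itens X Y)) :=
  bcomp (precomp (bcomp (postcomp (bidual_emb Y)) (subsp_incl (itens_space X Y))))
        (subsp_incl (ptens_space (dual X) (dual Y))).

Lemma GhatE (f : dual X) (g : dual Y) (x : X) (y : Y) :
  Ghat (ptens_mk f g) (itens_mk x y) = f x * g y.
Proof. by rewrite /= linearZ. Qed.

Lemma Ghat_unique (H : bop (ptens (dual X) (dual Y)) (dual (itens X Y))) :
  (forall f g x y, H (ptens_mk f g) (itens_mk x y) = f x * g y) -> H = Ghat.
Proof.
move=> HE; apply: closed_span_ext => v Gv; have [[f g] _ fgv] := Gv.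
have -> : Subsp (closed_span_mem Gv) = ptens_mk f g by apply: val_inj.
apply: closed_span_ext => u Gu; have [[x y] _ xyu] := Gu.
have -> : Subsp (closed_span_mem Gu) = itens_mk x y by apply: val_inj.
by rewrite HE GhatE.
Qed.

End CanonicalMap.

Section IdealGeneratedAssignment.
Context {R : realType}.
Local Notation banach := (completeNormedModType R).
Implicit Type I : forall X : banach, set (set (dual X)).

Definition Delta0 I (X : banach) : set (bidual X) :=
  [set phi | forall A, I X A -> exists x : X, forall f, A f -> phi f = f x].

Arguments Delta0 I X _ : clear implicits.

Lemma Delta0_submod I (X : banach) : submod_closed [in Delta0 I X].
Proof.
split; first by rewrite inE => A _; exists 0 => f _; rewrite linear0.
move=> a phi psi; rewrite !inE => Iphi Ipsi A IA.
have [x xA] := Iphi A IA; have [y yA] := Ipsi A IA.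
by exists (a *: x + y) => f Af; rewrite bopDE bopZE xA// yA// bopDZ.
Qed.

Definition Delta_space I (X : banach) : closedSubspace (bidual X) :=
  mk_closedSubspace (closure_submod (@Delta0_submod I X))
    (@closed_closure _ (Delta0 I X)).

Definition Delta I (X : banach) : banach := subsp (Delta_space I X).

Lemma bidual_emb_Delta I (X : banach) (x : X) :
  bidual_emb X x \in Delta_space I X.
Proof. by rewrite inE; apply: subset_closure => A _; exists x. Qed.

Definition Delta_ev I (X : banach) (x : X) : Delta I X :=
  Subsp (bidual_emb_Delta I x).

Lemma Delta_ev_linear I (X : banach) : linear (@Delta_ev I X).
Proof. by move=> a x y; apply: val_inj; exact: bidual_emb_linear. Qed.

Definition Delta_emb I (X : banach) : bop X (Delta I X) :=
  mkbop (@Delta_ev_linear I X) (ex_intro _ _ (@bidual_emb_le R X)).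

Lemma Delta_emb_norm I (X : banach) (x : X) : `|Delta_emb I X x| = `|x|.
Proof. exact: bidual_emb_norm. Qed.

Lemma range_submod (X Y : banach) (f : bop X Y) : submod_closed [in range f].
Proof.
split; first by rewrite inE; exists 0 => //; rewrite linear0.
move=> a u v; rewrite !inE => -[x _ <-] [y _ <-].
by exists (a *: x + y) => //; rewrite bopDZ.
Qed.

(* X as a closed subspace of Delta I X. *)
Definition in_Delta I (X : banach) : closedSubspace (Delta I X) :=
  mk_closedSubspace (range_submod (Delta_emb I X))
    (isometric_range_closed (@Delta_emb_norm I X)).

Definition S_quot I (X : banach) : banach := quotsp (in_Delta I X).

End IdealGeneratedAssignment.

(* In testing_slice, membership of A in the ideal of L(X, Y^* ) is read through
   the identification ptens_form with the dual of ptens X Y. *)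
Record testing_ideal {R : realType}
    (I : forall X : completeNormedModType R, set (set (dual X))) : Prop := {
  testing_set0 : forall X, I X set0 ;
  testing_subset : forall X A B, A `<=` B -> I X B -> I X A ;
  testing_setU : forall X A B, I X A -> I X B -> I X (A `|` B) ;
  testing_countable : forall X A, countable A -> I X A ;
  testing_adjoint : forall (X Y : completeNormedModType R) (T : bop X Y) A,
    I Y A -> I X [set bcomp f T | f in A] ;
  testing_slice : forall (X Y : completeNormedModType R)
      (A : set (bop X (dual Y))) (phi : bidual Y),
    I (ptens X Y) [set ptens_form T | T in A] ->
    phi \in Delta_space I Y ->
    I X [set bcomp phi T | T in A] }.

Section AssociatedOperator.
Context {R : realType} (X Y : completeNormedModType R).

Section fixed_functional.
Variable Phi : bidual (itens X Y).

Lemma L_op_linear (f : dual X) :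
  linear (fun g : dual Y => Phi (Ghat X Y (ptens_mk f g)) : R^o).
Proof. by move=> a g h; rewrite ptens_mk_linear_r !bopDZ. Qed.

Lemma L_op_le (f : dual X) (g : dual Y) :
  `|Phi (Ghat X Y (ptens_mk f g))| <= `|Phi| * `|Ghat X Y| * `|f| * `|g|.
Proof.
apply: le_trans (bop_normP _ _) _; rewrite -!mulrA ler_wpM2l//.
apply: le_trans (bop_normP _ _) _; rewrite ler_wpM2l//.
exact: ptens_mk_norm_le.
Qed.

Definition L_op (f : dual X) : bidual Y :=
  mkbop (L_op_linear f) (ex_intro _ _ (L_op_le f)).

End fixed_functional.
End AssociatedOperator.

(* Linearity and boundedness are part of the type bop. *)
Definition isometric_iso {R : realType} {E F : normedModType R} (T : bop E F) :=
  (forall x, `|T x| = `|x|) /\ (forall y, exists x, T x = y).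

(* M is the range of a bounded linear projection of E. *)
Definition complemented {R : realType} {E : normedModType R}
    (M : closedSubspace E) :=
  exists P : bop E E, (forall x, P x \in M) /\ (forall x, x \in M -> P x = x).

Definition isomorphic {R : realType} (E F : normedModType R) :=
  exists (f : bop E F) (g : bop F E), cancel f g /\ cancel g f.

(* Main.v *)
Require Import Defs.
From HB Require Import structures.
From mathcomp Require Import all_boot all_order all_algebra.
From mathcomp Require Import all_classical all_reals all_analysis.
Set Implicit Arguments.
Unset Strict Implicit.
Unset Printing Implicit Defensive.
Import Order.TTheory GRing.Theory Num.Theory.
Import numFieldNormedType.Exports.
Local Open Scope ring_scope.

(** Write D for Delta(Y), q : D -> D/Y for the quotient map and W for the
    injective tensor product of X and Y. A projection P of D onto Y factors as
    iota o p with iota : Y -> D the embedding, and id - P descends to a linear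
    section s of q, with s o q = id - P. Since T carries the canonical copy of W
    onto the range of id (x) iota, the operator (id (x) q) o T vanishes on W and
    descends to the quotient of Delta(W) by W; the class of T^-1 o (id (x) s) is
    its inverse, because id - (id (x) s)(id (x) q) = (id (x) iota)(id (x) p) has
    range in T(W). *)

(** An isometry is injective, so pointwise chosen preimages are forced to depend linearly on [z],
    and [k] inherits the bound of [h]. This gives both the corestriction of a projection and the
    composition of [h] with an inverse. *)
Lemma isometric_factor {R : realType} {E F Z : normedModType R}
    (f : bop E F) (h : bop Z F) :
  (forall x, `|f x| = `|x|) -> (forall z, exists x, f x = h z) ->
  exists k : bop Z E, forall z, f (k z) = h z.
Proof.
move=> fi fh; pose k z := sval (cid (fh z)).
have kE z : f (k z) = h z := svalP (cid (fh z)).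
have f_inj x y : f x = f y -> x = y.
  move=> fxy; apply/eqP; rewrite -subr_eq0 -normr_eq0 -fi bopB fxy subrr.
  by rewrite normr0.
have lk : linear k by move=> a x y; apply: f_inj; rewrite bopDZ !kE bopDZ.
have bk : exists C : R, forall z, `|k z| <= C * `|z|.
  by exists `|h| => z; rewrite -fi kE bop_normP.
by exists (mkbop lk bk).
Qed.

(** Two representatives of a class differ by an element of [M], which [f] kills. The bound [|f|]
    comes from representatives with norm arbitrarily close to the quotient norm. *)
Lemma quotsp_factor {R : realType} {E F : normedModType R}
    (M : closedSubspace E) (f : bop E F) :
  (forall x, x \in M -> f x = 0) ->
  exists g : bop (quotsp M) F, forall x, g (quotsp_pi M x) = f x.
Proof.
move=> f0; pose g (c : quotsp M) : F := f (sval (cid (quotsp_surj c))).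
have gE x : g (quotsp_pi M x) = f x.
  apply/eqP; rewrite -subr_eq0 -bopB; apply/eqP/f0/quotsp_piP.
  exact: svalP (cid (quotsp_surj (quotsp_pi M x))).
have lg : linear g.
  move=> a c d; have [x <-] := quotsp_surj c; have [y <-] := quotsp_surj d.
  by rewrite -quotsp_pi_linear !gE bopDZ.
have bg : exists C : R, forall c, `|g c| <= C * `|c|.
  exists `|f| => c; apply/ler_addgt0Pr => e e0.
  (* Lifting with excess [e / (|f| + 1)] costs less than [e] after [f]; the added 1 covers
     [f = 0]. *)
  have d0 : 0 < `|f| + 1 by rewrite ltr_wpDl.
  have [x <- xe] := quotsp_lift c (divr_gt0 e0 d0).
  rewrite gE; apply: le_trans (bop_normP f x) _.
  apply: le_trans (ler_wpM2l (normr_ge0 f) (ltW xe)) _.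
  by rewrite mulrDr lerD2l mulrA ler_pdivrMr// mulrC ler_pM2l// lerDl.
by exists (mkbop lg bg).
Qed.

Lemma bop_id_bounded {R : realType} (E : normedModType R) :
  exists C : R, forall x : E, `|id x| <= C * `|x|.
Proof. by exists 1 => x; rewrite mul1r. Qed.

Definition bop_id {R : realType} (E : normedModType R) : bop E E :=
  mkbop (fun a x y => erefl (a *: x + y)) (bop_id_bounded E).

Section InjectiveTensorMap.
Context {R : realType} (X : completeNormedModType R).
Context {Z W : completeNormedModType R}.
Variable A : bop Z W.

(** Composition with [A] sends the tensor of [a] and [z] to that of [a] and [A z]. The [u] with
    image in the closed subspace [itens_space X W] form a closed subspace, so closed-span induction
    applies. *)
Lemma itens_map_mem (u : itens X Z) :
  bcomp A (subsp_val u) \in itens_space X W.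
Proof.
pose h : bop (itens X Z) (bop (dual X) W) :=
  bcomp (postcomp A) (subsp_incl (itens_space X Z)).
apply: (@closed_span_ind _ _ _ (fun u : itens X Z => h u \in itens_space X W)).
- move=> x Gx; have [[a z] _ azx] := Gx.
  have -> : h (Subsp (closed_span_mem Gx)) = itens_op a (A z).
    by apply: bopE => f; rewrite /= -azx /= linearZ.
  exact: subspP (itens_mk a (A z)).
- split=> [|a v w]; first by apply/mem_set; rewrite linear0 rpred0.
  move=> /set_mem hv /set_mem hw; apply/mem_set.
  by rewrite bopDZ rpredD// rpredZ.
- apply: (@closed_comp _ _ h [set` itens_space X W]).
    by move=> v _; exact: bop_continuous.
  exact: csub_closed.
Qed.

Lemma itens_map_linear :
  linear (fun u : itens X Z => Subsp (itens_map_mem u) : itens X W).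
Proof.
by move=> a u v; apply: val_inj; exact: (bopDZ (postcomp A)).
Qed.

Lemma itens_map_le (u : itens X Z) :
  `|Subsp (itens_map_mem u) : itens X W| <= `|A| * `|u|.
Proof. exact: bcomp_norm. Qed.

(** The operator id (x) [A], which in the operator picture is composition with [A]. *)
Definition itens_map : bop (itens X Z) (itens X W) :=
  mkbop itens_map_linear (ex_intro _ _ itens_map_le).

Lemma itens_mapE u f : subsp_val (itens_map u) f = A (subsp_val u f).
Proof. by []. Qed.

End InjectiveTensorMap.

Lemma itens_ext {R : realType} (X Z : completeNormedModType R)
  (u v : itens X Z) : (forall f, subsp_val u f = subsp_val v f) -> u = v.
Proof. by move=> uv; apply: val_inj; exact: bopE. Qed.

Theorem theorem4p7 (R : realType) (X Y : completeNormedModType R)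
  (I : forall X : completeNormedModType R, set (set (dual X)))
  (hI : testing_ideal I)
  (T : bop (Delta I (itens X Y)) (itens X (Delta I Y)))
  (TE : forall (Phi : Delta I (itens X Y)) (f : dual X),
     subsp_val (subsp_val (T Phi) f) = L_op (subsp_val Phi) f)
  (Tiso : isometric_iso T)
  (Ycompl : complemented (in_Delta I Y)) :
  isomorphic (S_quot I (itens X Y)) (itens X (S_quot I Y)).
Proof.
have [Tnorm Tonto] := Tiso; have [P [PM Pid]] := Ycompl.
have embM (E : completeNormedModType R) (x : E) :
    Delta_emb I E x \in in_Delta I E by rewrite inE; exists x.
have [p pE] : exists p : bop (Delta I Y) Y, forall d, Delta_emb I Y (p d) = P d.
  apply: isometric_factor => [|d]; first exact: Delta_emb_norm.
  by have := PM d; rewrite inE => -[y _ <-]; exists y.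
pose q : bop (Delta I Y) (S_quot I Y) := quotsp_proj (in_Delta I Y).
have [s sq] : exists s : bop (S_quot I Y) (Delta I Y),
    forall d, s (quotsp_pi (in_Delta I Y) d) = d - P d.
  have [s sE] : exists s : bop (S_quot I Y) (Delta I Y),
      forall d, s (quotsp_pi (in_Delta I Y) d) = (bop_id (Delta I Y) - P) d.
    by apply: quotsp_factor => d dM; rewrite bopBE Pid// subrr.
  by exists s => d; rewrite sE.
have qs c : q (s c) = c.
  (* [d - P d] and [d] have the same class because [P d] lies in the copy of [Y]. *)
  have [d <-] := quotsp_surj c; rewrite sq; apply/quotsp_piP.
  by rewrite addrAC subrr sub0r rpredN.
have T_emb w : T (Delta_emb I _ w) = itens_map X (Delta_emb I Y) w.
  apply: itens_ext => f; apply: val_inj.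
  (* At [f] and then [g] in the dual of [Y], both sides compute to [g (w f)]. *)
  by apply: (etrans (TE _ _)); apply: bopE.
have [F FE] : exists F : bop (S_quot I (itens X Y)) (itens X (S_quot I Y)),
    forall Phi, F (quotsp_pi (in_Delta I _) Phi) = itens_map X q (T Phi).
  apply: (@quotsp_factor _ _ _ _ (bcomp (itens_map X q) T)) => Phi.
  rewrite inE => -[w _ <-]; rewrite [LHS]/= T_emb; apply: itens_ext => f.
  rewrite !itens_mapE; apply: (etrans _ (linear0 q)); apply/quotsp_piP.
  by rewrite subr0 embM.
have [k kE] : exists k : bop (itens X (S_quot I Y)) (Delta I (itens X Y)),
    forall v, T (k v) = itens_map X s v.
  by apply: isometric_factor => // v; exact: Tonto.
exists F, (bcomp (quotsp_proj (in_Delta I (itens X Y))) k).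
split=> [c|v]; last first.
  by rewrite [LHS]FE kE; apply: itens_ext => f; rewrite !itens_mapE qs.
have [Phi <-] := quotsp_surj c; rewrite FE; apply/esym/quotsp_piP.
have -> : Phi - k (itens_map X q (T Phi)) =
    Delta_emb I _ (itens_map X p (T Phi)).
  (* By injectivity of [T] it suffices to compare images. At [f], with [d] the value of [T Phi], the
     claim reads [d - (d - P d) = P d]. *)
  apply/eqP; rewrite -subr_eq0 -normr_eq0 -Tnorm normr_eq0 bopB subr_eq0.
  apply/eqP; rewrite T_emb bopB kE; apply: itens_ext => f.
  rewrite [LHS]bopBE !itens_mapE pE [X in _ - X]sq.
  by rewrite opprB addrC subrK.
exact: embM.
Qed.
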